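(* Let $F_L(z)=D_L+C_L(zI_n-A_L)^{-1}B_L$ be a $p\times p$-valued rational function of McMillan degree $n$, and let $f_R(z)$ be a scalar-valued rational function of McMillan degree $m$, of the form $$f_R(z)=d_R+c_R(zI_m-A_R)^{-1}b_R,$$ both realizations being minimal, and assume that the composition $F_L(f_R)$ is well defined. Then $$F_L(f_R(z))=D_L+C_L\left(f_R(z)I_n-A_L\right)^{-1}B_L$$ admits a state-space realization of the form $$F_L(f_R(z))=D_{\rm comp}+C_{\rm comp}(zI_k-A_{\rm comp})^{-1}B_{\rm comp},$$ of state dimension $k=mn$, with $$A_{\rm comp}=I_n\otimes A_R-(I_n\otimes b_R)(d_RI_n-A_L)^{-1}(I_n\otimes c_R),\qquad B_{\rm comp}=-(I_n\otimes b_R)(d_RI_n-A_L)^{-1}B_L,$$ $$C_{\rm comp}=C_L(d_RI_n-A_L)^{-1}(I_n\otimes c_R),\qquad D_{\rm comp}=D_L+C_L(d_RI_n-A_L)^{-1}B_L.$$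
   Context: All matrices are complex: $A_L$ is $n\times n$, $B_L$ is $n\times p$, $C_L$ is $p\times n$, $D_L$ is $p\times p$, $A_R$ is $m\times m$, $b_R$ is $m\times 1$, $c_R$ is $1\times m$ and $d_R$ is a scalar. A realization $F(z)=D+C(zI_n-A)^{-1}B$ of a rational function analytic at infinity is minimal if the size $n$ of $A$ is the smallest possible; this $n$ is the McMillan degree of $F$. The state dimension of a realization is the size of its matrix $A$. $\otimes$ denotes the Kronecker product: for $M=(m_{ij})$, $M\otimes N$ is the block matrix whose $(i,j)$ block is $m_{ij}N$. *)

(* Defs.v *)
From mathcomp Require Import all_boot all_order all_algebra.
From mathcomp Require Import fraction mxtens.

Set Implicit Arguments.
Unset Strict Implicit.
Unset Printing Implicit Defensive.

Import GRing.Theory.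
Local Open Scope ring_scope.

Notation ratfun C := {fraction {poly C}}.

Section RationalFunctions.
Variable C : fieldType.
Local Notation "x %:F" := (@tofrac _ x).

Implicit Types (g f h : ratfun C) (p q : {poly C}).

Definition ratC : {rmorphism C -> ratfun C} := (@tofrac _) \o polyC.

Definition ratz : ratfun C := 'X%:F.

(* p(f), the polynomial p evaluated at the rational function f. *)
Definition poly_at p f : ratfun C := (map_poly ratC p).[f].

(* h(z) = g(f(z)): g is written as p / q, and the composition makes sense when
   q(f) is not the zero function.  The fraction p / q need not be reduced; by
   ratcomp_unique the function h does not depend on it. *)
Definition is_ratcomp g f h : Prop :=
  exists p q, [/\ poly_at q f != 0, g = p%:F / q%:F
                & h = poly_at p f / poly_at q f].

Definition analytic_at_infty g : Prop :=
  exists p q, [/\ q != 0, (size p <= size q)%N & g = p%:F / q%:F].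

Lemma poly_atM p q f : poly_at (p * q) f = poly_at p f * poly_at q f.
Proof. by rewrite /poly_at rmorphM hornerM. Qed.

Lemma ratcomp_unique g f h1 h2 :
  is_ratcomp g f h1 -> is_ratcomp g f h2 -> h1 = h2.
Proof.
have nz p : poly_at p f != 0 -> p%:F != 0.
  rewrite tofrac_eq0; apply: contraNneq => ->.
  by rewrite /poly_at rmorph0 horner0.
move=> [p1 [q1 [n1 -> ->]]] [p2 [q2 [n2 e ->]]].
move/eqP: e; rewrite eqr_div ?nz // -!tofracM tofrac_eq => /eqP e.
apply/eqP; rewrite (eqr_div _ _ n1 n2); apply/eqP.
exact: etrans (esym (poly_atM _ _ _)) (etrans (congr1 (fun p => poly_at p f) e) (poly_atM _ _ _)).
Qed.

End RationalFunctions.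

Section Realizations.
Variable C : fieldType.

Definition cstmx m n (M : 'M[C]_(m, n)) : 'M[ratfun C]_(m, n) :=
  map_mx (@ratC C) M.

(* D + B' (g I - A)^-1 B for a scalar rational function g, where B' is the
   output matrix; g I - A is invertible for g = z, its determinant being the
   characteristic polynomial of A. *)
Definition tf_at (g : ratfun C) n p q (A : 'M[C]_n) (B : 'M[C]_(n, q))
    (C' : 'M[C]_(p, n)) (D : 'M[C]_(p, q)) : 'M[ratfun C]_(p, q) :=
  cstmx D + cstmx C' *m invmx (g%:M - cstmx A) *m cstmx B.

Definition tf := tf_at (ratz C).

Definition minimal_realization p q (F : 'M[ratfun C]_(p, q)) n (A : 'M[C]_n)
    (B : 'M[C]_(n, q)) (C' : 'M[C]_(p, n)) (D : 'M[C]_(p, q)) : Prop :=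
  F = tf A B C' D /\
  forall k (A1 : 'M[C]_k) (B1 : 'M[C]_(k, q)) (C1 : 'M[C]_(p, k))
    (D1 : 'M[C]_(p, q)), F = tf A1 B1 C1 D1 -> (n <= k)%N.

Definition mcmillan_degree p q (F : 'M[ratfun C]_(p, q)) (n : nat) : Prop :=
  exists A B C' D, @minimal_realization p q F n A B C' D.

Definition is_composition p q (F : 'M[ratfun C]_(p, q)) (f : ratfun C)
    (G : 'M[ratfun C]_(p, q)) : Prop :=
  forall i j, is_ratcomp (F i j) f (G i j).

(* F(f) exists and is analytic at infinity.  The second clause is part of being
   well defined here: all functions are taken analytic at infinity, and for
   F(w) = 1/w, f(z) = 1/z the composition z has no realization. *)
Definition composition_well_defined p q (F : 'M[ratfun C]_(p, q))
    (f : ratfun C) : Prop :=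
  exists2 G, is_composition F f G & forall i j, analytic_at_infty (G i j).

End Realizations.

Section Composition.
Variables (C : fieldType) (n p m : nat).
Variables (A_L : 'M[C]_n) (B_L : 'M[C]_(n, p)) (C_L : 'M[C]_(p, n)).
Variables (D_L : 'M[C]_p).
Variables (A_R : 'M[C]_m) (b_R : 'cV[C]_m) (c_R : 'rV[C]_m) (d_R : C).

(* The Kronecker products have sizes (n * m, n * 1) and (n * 1, n * m). *)
Definition I_tens_b : 'M[C]_(n * m, n) :=
  castmx (erefl, muln1 n) ((1%:M : 'M[C]_n) *t b_R).

Definition I_tens_c : 'M[C]_(n, n * m) :=
  castmx (muln1 n, erefl) ((1%:M : 'M[C]_n) *t c_R).

Definition A_comp : 'M[C]_(n * m) :=
  (1%:M : 'M[C]_n) *t A_R - I_tens_b *m invmx (d_R%:M - A_L) *m I_tens_c.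

Definition B_comp : 'M[C]_(n * m, p) :=
  - (I_tens_b *m invmx (d_R%:M - A_L) *m B_L).

Definition C_comp : 'M[C]_(p, n * m) :=
  C_L *m invmx (d_R%:M - A_L) *m I_tens_c.

Definition D_comp : 'M[C]_p :=
  D_L + C_L *m invmx (d_R%:M - A_L) *m B_L.

End Composition.

(* Main.v *)
(* The rational functions g for which g o f exists and is proper form a ring
   containing z.  If (A, B, C) is minimal, hence observable and controllable,
   and the entries of D + C (z - A)^-1 B lie in that ring, then so do those of
   (z - A)^-1, and so does 1 / chi for chi = char_poly A.  Hence
   chi(f) (1 / chi)(f) = 1 with a proper second factor, so chi(f) does not
   vanish identically nor at infinity, where it takes the value chi(d_R).
   The realization follows from the identity
   (I (x) c_R) (I (x) (z - A_R))^-1 (I (x) b_R) = (f_R - d_R) I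
   and the Woodbury formula for z - A_comp. *)
Require Import Defs.
From mathcomp Require Import all_boot all_order all_algebra.
From mathcomp Require Import fraction complex mxtens reals.
From mathcomp Require Import perm zify.

Set Implicit Arguments.
Unset Strict Implicit.
Unset Printing Implicit Defensive.

Import GRing.Theory.
Local Open Scope ring_scope.

(** * Proper and strictly proper rational functions, and composition with f *)

Section ProperFunctions.
Variable C : fieldType.
Implicit Types (f g h : ratfun C) (p q : {poly C}).
Local Notation "x %:F" := (@tofrac _ x).

(** The strict size bound already forces [q != 0], the zero polynomial having size 0. *)
Definition strictly_proper g : Prop :=
  exists p q, (size p < size q)%N /\ g = p%:F / q%:F.

Lemma size_polyM_mono p q p' q' : q != 0 -> q' != 0 ->
  (size p <= size q)%N -> (size p' <= size q')%N ->
  (size (p * p')%R <= size (q * q')%R)%N.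
Proof.
move=> nq nq' le_pq le_pq'; rewrite (size_mul nq nq').
apply: leq_trans (size_polyMleq p p') _.
by rewrite -!subn1 leq_sub2r // leq_add.
Qed.

Lemma size_polyM_smono p q p' q' : q' != 0 ->
  (size p < size q)%N -> (size p' <= size q')%N ->
  (size (p * p')%R < size (q * q')%R)%N.
Proof.
move=> nq' lt_pq le_pq'.
have nq : q != 0 by rewrite -size_poly_gt0; apply: leq_ltn_trans lt_pq.
rewrite (size_mul nq nq'); apply: leq_ltn_trans (size_polyMleq p p') _.
(* The bound on the size of [p * p'] is a truncated predecessor: [size q' > 0] keeps the inequality
   strict when [p] and [p'] both vanish. *)
move: nq'; rewrite -size_poly_gt0.
move: (size p) (size p') (size q) (size q') lt_pq le_pq' => a b c d; lia.
Qed.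

Lemma analytic_const (c : C) : analytic_at_infty (ratC C c).
Proof.
exists c%:P, 1; rewrite oner_neq0 size_poly1 size_polyC_leq1 tofrac1 divr1.
by split.
Qed.

Lemma analyticD g h :
  analytic_at_infty g -> analytic_at_infty h -> analytic_at_infty (g + h).
Proof.
move=> [p [q [nq le_pq ->]]] [p' [q' [nq' le_pq' ->]]].
exists (p * q' + p' * q), (q * q'); split; first by rewrite mulf_neq0.
  apply: leq_trans (size_polyD _ _) _; rewrite [q * q']mulrC geq_max.
  rewrite [p * q']mulrC [p' * q]mulrC size_polyM_mono // [q' * q]mulrC.
  exact: size_polyM_mono.
by rewrite addf_div ?tofrac_eq0 // -!tofracM -tofracD.
Qed.

Lemma analyticM g h :
  analytic_at_infty g -> analytic_at_infty h -> analytic_at_infty (g * h).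
Proof.
move=> [p [q [nq le_pq ->]]] [p' [q' [nq' le_pq' ->]]].
exists (p * p'), (q * q'); split; first by rewrite mulf_neq0.
  exact: size_polyM_mono.
by rewrite mulf_div -!tofracM.
Qed.

Lemma strictly_properM g h :
  strictly_proper g -> analytic_at_infty h -> strictly_proper (g * h).
Proof.
move=> [p [q [lt_pq ->]]] [p' [q' [nq' le_pq' ->]]].
exists (p * p'), (q * q'); split; last by rewrite mulf_div -!tofracM.
exact: size_polyM_smono.
Qed.

Lemma strictly_proper_analytic g : strictly_proper g -> analytic_at_infty g.
Proof.
move=> [p [q [lt_pq ->]]]; exists p, q; split=> //; last exact: ltnW.
by rewrite -size_poly_gt0; apply: leq_ltn_trans lt_pq.
Qed.

(** Replaces evaluation at infinity: p / q = 1 would give p = q, against the strict size bound. *)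
Lemma strictly_proper_neq1 : ~ strictly_proper 1.
Proof.
move=> [p [q [lt_pq /esym/eqP]]].
have nq : q%:F != 0.
  by rewrite tofrac_eq0 -size_poly_gt0; apply: leq_ltn_trans lt_pq.
rewrite -(mulr1 (p%:F / _)) mulrAC (can2_eq (divfK nq) (mulfK nq)) mulr1 mul1r.
by rewrite tofrac_eq => /eqP e; move: lt_pq; rewrite e ltnn.
Qed.

(** Bundled as a ring morphism, evaluation at f can be mapped over polynomial matrices and commutes
    with determinants and adjugates. *)
Definition poly_at_morph f : {rmorphism {poly C} -> ratfun C} :=
  horner_morph (fun x => mulrC f (ratC C x)).

Lemma poly_at_morphE f p : poly_at p f = poly_at_morph f p.
Proof. by []. Qed.

Lemma poly_atX f : poly_at 'X f = f.
Proof. exact: (horner_morphX (fun x => mulrC f (ratC C x))). Qed.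

Lemma poly_atC f c : poly_at c%:P f = ratC C c.
Proof. exact: (horner_morphC (fun x => mulrC f (ratC C x))). Qed.

Lemma poly_atD p q f : poly_at (p + q) f = poly_at p f + poly_at q f.
Proof. exact: (rmorphD (poly_at_morph f)). Qed.

Lemma poly_atB p q f : poly_at (p - q) f = poly_at p f - poly_at q f.
Proof. exact: (rmorphB (poly_at_morph f)). Qed.

Lemma poly_at0 f : poly_at 0 f = 0.
Proof. exact: (rmorph0 (poly_at_morph f)). Qed.

Lemma poly_at1 f : poly_at 1 f = 1.
Proof. exact: (rmorph1 (poly_at_morph f)). Qed.

(* Unqualified, ratz is the map from int to rat. *)
Lemma poly_at_z p : poly_at p (Defs.ratz C) = p%:F.
Proof.
elim/poly_ind: p => [|p c IHp]; first by rewrite poly_at0 tofrac0.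
rewrite (poly_atD (p * 'X) c%:P) (poly_atM p 'X) IHp poly_atX poly_atC.
by rewrite (tofracD (p * 'X) c%:P) tofracM.
Qed.

Lemma analytic_poly_at p f : analytic_at_infty f -> analytic_at_infty (poly_at p f).
Proof.
move=> af; elim/poly_ind: p => [|p c IHp].
  by rewrite poly_at0 -(rmorph0 (ratC C)); apply: analytic_const.
rewrite (poly_atD (p * 'X) c%:P) (poly_atM p 'X) poly_atX poly_atC.
by apply: analyticD (analytic_const c); apply: analyticM.
Qed.

(** Writing p = q (X - d), the factor f - d of p(f) is strictly proper and the cofactor q(f) is
    proper. *)
Lemma poly_at_root_strictly_proper p f d :
  strictly_proper (f - ratC C d) -> root p d -> strictly_proper (poly_at p f).
Proof.
move=> spf /factor_theorem[q ->].
rewrite (poly_atM q ('X - d%:P)) (poly_atB 'X) poly_atX poly_atC mulrC.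
apply: strictly_properM (spf) _; apply: analytic_poly_at.
rewrite -(subrK (ratC C d) f).
by apply: analyticD (strictly_proper_analytic spf) (analytic_const d).
Qed.

Lemma neq0_of_poly_at p f : poly_at p f != 0 -> p != 0.
Proof. by apply: contraNneq => ->; rewrite poly_at0. Qed.

Lemma ratcompD f g1 g2 h1 h2 :
  is_ratcomp g1 f h1 -> is_ratcomp g2 f h2 -> is_ratcomp (g1 + g2) f (h1 + h2).
Proof.
move=> [p [q [nq -> ->]]] [p' [q' [nq' -> ->]]].
exists (p * q' + p' * q), (q * q'); split.
- by rewrite (poly_atM q q' f) (mulf_neq0 nq nq').
- rewrite addf_div ?tofrac_eq0 ?(neq0_of_poly_at nq) ?(neq0_of_poly_at nq') //.
  by rewrite (tofracD (p * q') (p' * q)) !tofracM.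
- rewrite (addf_div _ _ nq nq') (poly_atM q q' f) (poly_atD (p * q') (p' * q)).
  by rewrite (poly_atM p q') (poly_atM p' q).
Qed.

Lemma ratcompM f g1 g2 h1 h2 :
  is_ratcomp g1 f h1 -> is_ratcomp g2 f h2 -> is_ratcomp (g1 * g2) f (h1 * h2).
Proof.
move=> [p [q [nq -> ->]]] [p' [q' [nq' -> ->]]].
exists (p * p'), (q * q'); split.
- by rewrite (poly_atM q q' f) (mulf_neq0 nq nq').
- by rewrite mulf_div (tofracM p p') (tofracM q q').
- by rewrite mulf_div (poly_atM q q' f) (poly_atM p p' f).
Qed.

Lemma ratcomp_poly f p : is_ratcomp p%:F f (poly_at p f).
Proof. by exists p, 1; rewrite tofrac1 poly_at1 !divr1 oner_neq0. Qed.

Lemma ratcomp_const f c : is_ratcomp (ratC C c) f (ratC C c).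
Proof. by have := ratcomp_poly f c%:P; rewrite poly_atC. Qed.

End ProperFunctions.

(** * Transfer functions as polynomial fractions; minimality and observability *)

Section TransferFunctions.
Variable C : fieldType.
Implicit Types (f g h : ratfun C).
Local Notation "x %:F" := (@tofrac _ x).

Lemma size_det_leq n (M : 'M[{poly C}]_n) :
  (forall i j, (size (M i j) <= 2)%N) -> (size (\det M) <= n.+1)%N.
Proof.
move=> sM; apply: leq_trans (size_sum _ _ _) _; apply/bigmax_leqP => s _.
rewrite size_Msign; apply: leq_trans (size_poly_prod_leq _ _) _.
rewrite cardT size_enum_ord.
have : (\sum_(i < n) size (M i (s i)) <= \sum_(i < n) 2)%N by apply: leq_sum.
rewrite sum_nat_const card_ord; move: (\sum_(_ < _) _)%N => k; lia.
Qed.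

Lemma size_char_poly_mx n (A : 'M[C]_n) i j : (size (char_poly_mx A i j) <= 2)%N.
Proof.
rewrite !mxE; apply: leq_trans (size_polyD _ _) _.
rewrite size_polyN geq_max (leq_trans (size_polyC_leq1 _)) // andbT.
by case: (i == j); rewrite ?mulr1n ?mulr0n ?size_polyX ?size_poly0.
Qed.

(** Cofactors are minors of order n - 1 with entries of degree at most 1, so their degree is below
    that of [char_poly A]. *)
Lemma size_adj_char_poly_mx n (A : 'M[C]_n) i j :
  (size (\adj (char_poly_mx A) i j) <= n)%N.
Proof.
case: n A i j => [|n] A i j; first by case: i.
rewrite mxE size_Msign; apply: size_det_leq => k l.
by rewrite 2!mxE; apply: size_char_poly_mx.
Qed.

Lemma cstmxM m n p (M : 'M[C]_(m, n)) (N : 'M[C]_(n, p)) :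
  cstmx (M *m N) = cstmx M *m cstmx N.
Proof. exact: map_mxM. Qed.

Lemma cstmxD m n (M N : 'M[C]_(m, n)) : cstmx (M + N) = cstmx M + cstmx N.
Proof. exact: map_mxD. Qed.

(** By Cramer's rule, the numerators of C' (z - A)^-1 B over the common denominator
    [char_poly A]. *)
Definition tf_num n p q (A : 'M[C]_n) (B : 'M[C]_(n, q)) (C' : 'M[C]_(p, n)) :=
  map_mx polyC C' *m \adj (char_poly_mx A) *m map_mx polyC B.

Lemma size_tf_num n p q (A : 'M[C]_n) (B : 'M[C]_(n, q)) (C' : 'M[C]_(p, n)) i j :
  (size (tf_num A B C' i j) <= n)%N.
Proof.
rewrite mxE; apply: leq_trans (size_sum _ _ _) _; apply/bigmax_leqP => k _.
rewrite [X in _ * X]mxE mulrC mul_polyC; apply: leq_trans (size_scale_leq _ _) _.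
rewrite mxE; apply: leq_trans (size_sum _ _ _) _; apply/bigmax_leqP => l _.
rewrite mxE mul_polyC; apply: leq_trans (size_scale_leq _ _) _.
exact: size_adj_char_poly_mx.
Qed.

Lemma map_poly_at_char_poly_mx n (A : 'M[C]_n) g :
  map_mx (poly_at_morph g) (char_poly_mx A) = g%:M - cstmx A.
Proof.
apply/matrixP=> i j; rewrite !mxE rmorphB rmorphMn -!poly_at_morphE.
by rewrite poly_atX poly_atC.
Qed.

Lemma det_sub_cstmx n (A : 'M[C]_n) g :
  \det (g%:M - cstmx A) = poly_at (char_poly A) g.
Proof. by rewrite -map_poly_at_char_poly_mx det_map_mx. Qed.

Lemma sub_cstmx_unit n (A : 'M[C]_n) g :
  (g%:M - cstmx A \in unitmx) = (poly_at (char_poly A) g != 0).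
Proof. by rewrite unitmxE det_sub_cstmx unitfE. Qed.

Lemma char_poly_at_z_neq0 n (A : 'M[C]_n) :
  poly_at (char_poly A) (Defs.ratz C) != 0.
Proof. by rewrite poly_at_z tofrac_eq0 monic_neq0 ?char_poly_monic. Qed.

Lemma z_sub_cstmx_unit n (A : 'M[C]_n) : (Defs.ratz C)%:M - cstmx A \in unitmx.
Proof. by rewrite sub_cstmx_unit char_poly_at_z_neq0. Qed.

(** One pair of polynomials serves every g: g = z gives the entries of F and g = f those of F(f),
    which is what [is_ratcomp] asks for. *)
Lemma tf_atE n p q (A : 'M[C]_n) (B : 'M[C]_(n, q)) (C' : 'M[C]_(p, n)) D g i j :
  poly_at (char_poly A) g != 0 ->
  tf_at g A B C' D i j =
    ratC C (D i j) + poly_at (tf_num A B C' i j) g / poly_at (char_poly A) g.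
Proof.
(* [invmx] is defined by cases; [nz] selects the adjugate formula. *)
move=> nz; rewrite /tf_at mxE [cstmx D i j]mxE /invmx sub_cstmx_unit nz.
rewrite -(map_poly_at_char_poly_mx A g) -map_mx_adj det_map_mx.
have e k l (M : 'M[C]_(k, l)) : cstmx M = map_mx (poly_at_morph g) (map_mx polyC M).
  by apply/matrixP=> i' j'; rewrite !mxE -poly_at_morphE poly_atC.
rewrite !e -scalemxAr -scalemxAl -!map_mxM mxE.
by rewrite [map_mx _ _ _ _]mxE mulrC.
Qed.

Lemma tf_is_composition n p q (A : 'M[C]_n) (B : 'M[C]_(n, q)) (C' : 'M[C]_(p, n))
    D f :
  f%:M - cstmx A \in unitmx ->
  is_composition (tf A B C' D) f (tf_at f A B C' D).
Proof.
rewrite sub_cstmx_unit => nz i j.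
have ez := tf_atE B C' D i j (char_poly_at_z_neq0 A).
have ef := tf_atE B C' D i j nz.
(* [rewrite ez] would first try to convert f to z by unfolding both. *)
apply: (eq_ind_r (fun g => is_ratcomp g f _) _ ez).
apply: (eq_ind_r (fun h => is_ratcomp _ f h) _ ef).
apply: ratcompD (ratcomp_const f (D i j)) _.
by exists (tf_num A B C' i j), (char_poly A); split=> //; rewrite !poly_at_z.
Qed.

Lemma tf_strictly_proper n p q (A : 'M[C]_n) (B : 'M[C]_(n, q)) (C' : 'M[C]_(p, n))
    D i j :
  strictly_proper (tf A B C' D i j - ratC C (D i j)).
Proof.
rewrite /tf (tf_atE _ _ _ _ _ (char_poly_at_z_neq0 A)) !poly_at_z addrC addKr.
exists (tf_num A B C' i j), (char_poly A).
by rewrite size_char_poly ltnS size_tf_num.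
Qed.

Lemma tf_tr n p q (A : 'M[C]_n) (B : 'M[C]_(n, q)) (C' : 'M[C]_(p, n)) D :
  (tf A B C' D)^T = tf A^T C'^T B^T D^T.
Proof.
rewrite /tf /tf_at linearD /= !trmx_mul trmx_inv linearB /= tr_scalar_mx.
by rewrite /cstmx !map_trmx mulmxA.
Qed.

(** Duality: controllability is obtained as observability of the transposed realization. *)
Lemma minimal_realization_tr p q (F : 'M[ratfun C]_(p, q)) n (A : 'M[C]_n)
    (B : 'M[C]_(n, q)) (C' : 'M[C]_(p, n)) D :
  minimal_realization F A B C' D -> minimal_realization F^T A^T C'^T B^T D^T.
Proof.
move=> [-> minF]; split=> [|k A1 B1 C1 D1 e]; first exact: tf_tr.
apply: (minF k A1^T C1^T B1^T D1^T).
by rewrite -tf_tr -e trmxK.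
Qed.

(** Restricting the system to the row space of [W] gives a realization of the same function with
    state dimension [\rank W], so minimality forces [n <= \rank W]. *)
Lemma minimal_realization_observable p q (F : 'M[ratfun C]_(p, q)) n (A : 'M[C]_n)
    (B : 'M[C]_(n, q)) (C' : 'M[C]_(p, n)) D (W : 'M[C]_n) :
  minimal_realization F A B C' D ->
  (C' <= W)%MS -> (W *m A <= W)%MS -> row_full W.
Proof.
move=> [-> minF] sCW sWA; rewrite -col_leq_rank; set V := row_base W.
(* [A1] is the action of [A] on the stable row space, in the basis [V]. *)
have [A1 VA] : exists A1, A1 *m V = V *m A.
  exists (V *m A *m pinvmx V); rewrite mulmxKpV // eq_row_base.
  by apply: submx_trans sWA; rewrite submxMr // eq_row_base.
have [C1 CV] : exists C1, C1 *m V = C'.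
  by exists (C' *m pinvmx V); rewrite mulmxKpV // eq_row_base.
apply: (minF _ A1 (V *m B) C1 D).
have uA := z_sub_cstmx_unit A; have uA1 := z_sub_cstmx_unit A1.
(* The intertwining relation A1 V = V A passes to the resolvents. *)
have e : invmx ((Defs.ratz C)%:M - cstmx A1) *m cstmx V =
         cstmx V *m invmx ((Defs.ratz C)%:M - cstmx A).
  apply: (canRL (mulmxK uA)); rewrite -mulmxA; apply: (canLR (mulKmx uA1)).
  rewrite mulmxBl mulmxBr mul_scalar_mx mul_mx_scalar.
  by rewrite -(cstmxM A1 V) -(cstmxM V A) VA.
rewrite /tf /tf_at; congr (_ + _).
rewrite -CV (cstmxM V B) (cstmxM C1 V).
by rewrite !mulmxA -(mulmxA _ (invmx _) (cstmx V)) e !mulmxA.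
Qed.

End TransferFunctions.

(** * From the entries of F to its resolvent, inside a ring S containing z *)

Section Poles.
Variable C : fieldType.
Variable S : ratfun C -> Prop.
Hypothesis S_const : forall c, S (ratC C c).
Hypothesis S_z : S (Defs.ratz C).
Hypothesis S_add : forall g h, S g -> S h -> S (g + h).
Hypothesis S_mul : forall g h, S g -> S h -> S (g * h).

Definition mxS m n (M : 'M[ratfun C]_(m, n)) : Prop := forall i j, S (M i j).

Let S0 : S 0. Proof. by rewrite -(rmorph0 (ratC C)). Qed.
Let S1 : S 1. Proof. by rewrite -(rmorph1 (ratC C)). Qed.
Let SN1 : S (-1). Proof. by have := S_const (-1); rewrite rmorphN rmorph1. Qed.

Lemma mxS_cst m n (M : 'M[C]_(m, n)) : mxS (cstmx M).
Proof. by move=> i j; rewrite mxE. Qed.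

Lemma mxS_add m n (M N : 'M[ratfun C]_(m, n)) : mxS M -> mxS N -> mxS (M + N).
Proof. by move=> SM SN i j; rewrite mxE; apply: S_add. Qed.

Lemma mxS_scale m n g (M : 'M[ratfun C]_(m, n)) : S g -> mxS M -> mxS (g *: M).
Proof. by move=> Sg SM i j; rewrite mxE; apply: S_mul. Qed.

Lemma mxS_sub m n (M N : 'M[ratfun C]_(m, n)) : mxS M -> mxS N -> mxS (M - N).
Proof.
by move=> SM SN; rewrite -scaleN1r; apply: mxS_add (mxS_scale SN1 SN).
Qed.

Lemma mxS_tr m n (M : 'M[ratfun C]_(m, n)) : mxS M -> mxS M^T.
Proof. by move=> SM i j; rewrite mxE. Qed.

Lemma mxS_mul m n p (M : 'M[ratfun C]_(m, n)) (N : 'M[ratfun C]_(n, p)) :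
  mxS M -> mxS N -> mxS (M *m N).
Proof.
move=> SM SN i j; rewrite mxE; apply: (big_ind S) => // k _.
exact: S_mul.
Qed.

Lemma S_det n (M : 'M[ratfun C]_n) : mxS M -> S (\det M).
Proof.
move=> SM; apply: (big_ind S) => // s _; apply: S_mul.
  by case: (odd_perm s); rewrite ?expr0 ?expr1.
exact: (big_ind S).
Qed.

(* The rows u such that u (z - A)^-1 X has entries in S form a subspace stable
   under A, because A (z - A)^-1 = z (z - A)^-1 - 1; by observability it is
   everything as soon as it contains the rows of C'. *)
Lemma mxS_resolvent_observable p q (F : 'M[ratfun C]_(p, q)) n (A : 'M[C]_n)
    (B : 'M[C]_(n, q)) (C' : 'M[C]_(p, n)) D r (X : 'M[ratfun C]_(n, r)) :
  minimal_realization F A B C' D -> mxS X ->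
  mxS (cstmx C' *m invmx ((Defs.ratz C)%:M - cstmx A) *m X) ->
  mxS (invmx ((Defs.ratz C)%:M - cstmx A) *m X).
Proof.
move=> minF SX; set Y := invmx _ => SCY.
pose P (W : 'M[C]_n) := mxS (cstmx W *m (Y *m X)).
have PD W W' : P W -> P W' -> P (W + W').
  by move=> PW PW'; rewrite /P cstmxD mulmxDl; apply: mxS_add.
have PM N W : P W -> P (N *m W).
  by move=> PW; rewrite /P cstmxM -mulmxA; apply: mxS_mul => //; apply: mxS_cst.
have PA W : P W -> P (W *m A).
  move=> PW; rewrite /P cstmxM.
  have -> : cstmx W *m cstmx A *m (Y *m X) =
            (Defs.ratz C) *: (cstmx W *m (Y *m X)) - cstmx W *m X.
    have uA := z_sub_cstmx_unit A.
    rewrite -mulmxA (mulmxA (cstmx A)).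
    have -> : cstmx A *m Y = (Defs.ratz C) *: Y - 1%:M.
      rewrite -(mulmxV uA) -/Y mulmxBl mul_scalar_mx.
      by rewrite opprB addrC subrK.
    by rewrite mulmxBl mul1mx mulmxBr -scalemxAl -scalemxAr.
  by apply: mxS_sub (mxS_scale S_z PW) (mxS_mul (mxS_cst _) SX).
(* Induction on the codimension of [W]: either [W] is stable, hence full by observability, or
   [W + W *m A] has larger rank. *)
suff P1 k (W : 'M[C]_n) : (n - \rank W <= k)%N -> (C' <= W)%MS -> P W -> P 1%:M.
  have : P 1%:M.
    (* [<<C'>>] is a square matrix with the row space of [C'], as the type of [W] demands. *)
    apply: (P1 n <<C'>>%MS); rewrite ?leq_subr ?genmxE //.
    have /submxP[N ->] : (<<C'>> <= C')%MS by rewrite genmxE.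
    rewrite /P cstmxM -(mulmxA (cstmx N)); apply: mxS_mul (mxS_cst _) _.
    by rewrite mulmxA.
  by rewrite /P /cstmx map_mx1 mul1mx.
elim: k W => [|k IHk] W leWk sCW PW.
  have /row_fullP[N <-] : row_full W.
    by rewrite -col_leq_rank -subn_eq0 -leqn0.
  exact: PM.
have [sWA|nsWA] := boolP (W *m A <= W)%MS.
  have /row_fullP[N <-] := minimal_realization_observable minF sCW sWA.
  exact: PM.
apply: (IHk (W + W *m A)%MS).
- have : (\rank W < \rank (W + W *m A))%N.
    apply: rank_ltmx; rewrite ltmxE addsmxSl /=.
    by apply: contra nsWA; apply: submx_trans; apply: addsmxSr.
  move: leWk; move: (\rank W) (\rank _) => a b; lia.
- exact: submx_trans sCW (addsmxSl _ _).
- have /sub_addsmxP[[N N'] /= ->] : (W + W *m A <= W + W *m A)%MS by [].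
  by apply: PD; apply: PM => //; apply: PA.
Qed.

(** Observability strips [C'] from C' (z - A)^-1 B; the transposed realization, with X = 1, then
    strips [B]. *)
Lemma mxS_resolvent p q (F : 'M[ratfun C]_(p, q)) n (A : 'M[C]_n)
    (B : 'M[C]_(n, q)) (C' : 'M[C]_(p, n)) D :
  minimal_realization F A B C' D -> mxS F ->
  mxS (invmx ((Defs.ratz C)%:M - cstmx A)).
Proof.
move=> minF SF; have [FE _] := minF.
have SCB : mxS (cstmx C' *m invmx ((Defs.ratz C)%:M - cstmx A) *m cstmx B).
  have -> : cstmx C' *m invmx ((Defs.ratz C)%:M - cstmx A) *m cstmx B = F - cstmx D.
    by rewrite FE [tf _ _ _ _]addrC addrK.
  by apply: mxS_sub SF (mxS_cst _).
have SB := mxS_resolvent_observable minF (mxS_cst B) SCB.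
have S1n : mxS (1%:M : 'M[ratfun C]_n) by move=> i j; rewrite mxE; case: eqP.
have zTr : (Defs.ratz C)%:M - cstmx A^T = ((Defs.ratz C)%:M - cstmx A)^T.
  by rewrite linearB /= tr_scalar_mx /cstmx map_trmx.
have SBT : mxS (cstmx B^T *m invmx ((Defs.ratz C)%:M - cstmx A^T) *m 1%:M).
  by rewrite mulmx1 zTr -trmx_inv /cstmx -map_trmx -trmx_mul; apply: mxS_tr.
have := mxS_resolvent_observable (minimal_realization_tr minF) S1n SBT.
by rewrite mulmx1 zTr -trmx_inv => /mxS_tr; rewrite trmxK.
Qed.

(** 1 / chi is the determinant of the resolvent, a polynomial in entries lying in S. *)
Lemma S_inv_char_poly p q (F : 'M[ratfun C]_(p, q)) n (A : 'M[C]_n)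
    (B : 'M[C]_(n, q)) (C' : 'M[C]_(p, n)) D :
  minimal_realization F A B C' D -> mxS F -> S (tofrac (char_poly A))^-1.
Proof.
move=> minF SF; have := S_det (mxS_resolvent minF SF).
by rewrite det_inv det_sub_cstmx poly_at_z.
Qed.

End Poles.

(** * Well-defined composition makes d - A and f - A invertible *)

Section WellDefined.
Variable C : fieldType.

Lemma regular_of_composition_well_defined p q (F : 'M[ratfun C]_(p, q)) n
    (A : 'M[C]_n) (B : 'M[C]_(n, q)) (C' : 'M[C]_(p, n)) D
    (f : ratfun C) m (A_R : 'M[C]_m) b_R c_R d :
  minimal_realization F A B C' D ->
  (f%:M : 'M_1) = tf A_R b_R c_R d%:M ->
  composition_well_defined F f ->
  d%:M - A \in unitmx /\ f%:M - cstmx A \in unitmx.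
Proof.
move=> minF fE [G FG aG].
have spf : strictly_proper (f - ratC C d).
  have := tf_strictly_proper A_R b_R c_R d%:M 0 0.
  by rewrite -fE !mxE !mulr1n.
have af : analytic_at_infty f.
  rewrite -(subrK (ratC C d) f).
  exact: analyticD (strictly_proper_analytic spf) (analytic_const d).
pose S g := exists2 h, is_ratcomp g f h & analytic_at_infty h.
have S_const c : S (ratC C c).
  by exists (ratC C c); [exact: ratcomp_const | exact: analytic_const].
have S_z : S (Defs.ratz C).
  by exists f => //; have := ratcomp_poly f 'X; rewrite poly_atX.
have S_add g h : S g -> S h -> S (g + h).
  move=> [g' gg' ag'] [h' hh' ah'].
  by exists (g' + h'); [exact: ratcompD | exact: analyticD].
have S_mul g h : S g -> S h -> S (g * h).
  move=> [g' gg' ag'] [h' hh' ah'].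
  by exists (g' * h'); [exact: ratcompM | exact: analyticM].
have SF : mxS S F by move=> i j; exists (G i j).
have [h [P [Q [nQ e he]]] ah] := S_inv_char_poly S_const S_z S_add S_mul minF SF.
have invfMK (K : fieldType) (a b : K) : a * b != 0 -> b * (a / (a * b)) = 1.
  by move=> nab; rewrite mulrA (mulrC b) mulfV.
(* P / Q is some fraction, perhaps not reduced, equal to 1 / chi with Q(f) nonzero;
   cross-multiplication gives Q. *)
have QE : Q = P * char_poly A.
  apply/eqP; rewrite -tofrac_eq tofracM.
  have nQF : tofrac Q != 0 by rewrite tofrac_eq0 (neq0_of_poly_at nQ).
  have nchi : tofrac (char_poly A) != 0.
    by rewrite tofrac_eq0 monic_neq0 ?char_poly_monic.
  by rewrite -(divfK nQF (tofrac P)) -e mulrAC mulVf // mul1r.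
have Qf : poly_at Q f = poly_at P f * poly_at (char_poly A) f.
  by rewrite QE; apply: poly_atM.
have chi_h : poly_at (char_poly A) f * h = 1.
  by rewrite he Qf; apply: invfMK; rewrite -Qf.
have nchi : poly_at (char_poly A) f != 0.
  by apply: contraNneq nQ => chi0; rewrite Qf chi0 mulr0.
split; last by rewrite sub_cstmx_unit.
have dE : \det (d%:M - A) = (char_poly A).[d].
  rewrite -[RHS]horner_evalE -det_map_mx; congr (\det _).
  apply/matrixP => i j; rewrite !mxE /= horner_evalE.
  by rewrite hornerD hornerN hornerMn hornerX hornerC.
rewrite unitmxE unitfE dE.
(* If chi(d) = 0, then chi(f) is strictly proper, and so is its product 1 with the proper function
   h. *)
apply: contra_notN (@strictly_proper_neq1 C) => root_d.
rewrite -chi_h.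
exact: strictly_properM (poly_at_root_strictly_proper spf root_d) ah.
Qed.

End WellDefined.

(** * Woodbury and Kronecker identities *)

(** The last hypothesis makes s - A0 equal to L + V X^-1 U, so this is the Woodbury formula read
    from the smaller side. *)
Lemma woodbury_feedback (K : fieldType) (n k : nat) (A0 : 'M[K]_n) (s d : K)
    (X : 'M[K]_k) (U : 'M[K]_(k, n)) (V : 'M[K]_(n, k)) :
  let L := d%:M - A0 in
  X \in unitmx -> L \in unitmx -> s%:M - A0 \in unitmx ->
  X + U *m invmx L *m V \in unitmx ->
  V *m invmx X *m U = (s - d)%:M ->
  invmx (s%:M - A0) =
  invmx L - invmx L *m V *m invmx (X + U *m invmx L *m V) *m U *m invmx L.
Proof.
move=> L uX uL uM uY VXU; set Y := _ + _ *m V in uY *; set M := _ - A0 in uM *.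
have ML : M = L + (s - d)%:M by rewrite /M /L addrAC -raddfD /= addrCA subrr addr0.
(* Push-through identity: both sides equal V + (s - d) L^-1 V. *)
have e1 : V *m invmx X *m Y = M *m (invmx L *m V).
  rewrite mulmxDr mulmxKV // !mulmxA VXU ML.
  by rewrite mulmxDl (mulmxV uL) mulmxDl mul1mx.
have e2 : invmx L *m V *m invmx Y = invmx M *m (V *m invmx X).
  apply: (canRL (mulKmx uM)); rewrite mulmxA -e1.
  by rewrite mulmxK.
(* Multiplied by M on the left, the claim becomes (M - (s - d)) L^-1 = 1. *)
apply: (can_inj (mulKmx uM)).
rewrite e2 -(mulmxA (invmx M)) VXU -(mulmxA (invmx M)) mulmxBr (mulKVmx uM).
by rewrite -mulmxBl ML addrK (mulmxV uL) -ML mulmxV.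
Qed.

Lemma tens_scalar_sub (K : fieldType) k l (z : K) (N : 'M[K]_l) :
  (1%:M : 'M_k) *t (z%:M - N) = z%:M - 1%:M *t N.
Proof.
apply/matrixP => i j.
case: (mxtens_indexP i) => i0 i1; case: (mxtens_indexP j) => j0 j1.
rewrite tensmxE [RHS]mxE [in RHS]mxE [X in _ = _ + X]mxE tensmxE !mxE.
rewrite (can_eq (@mxtens_indexK _ _)) xpair_eqE.
by case: (i0 == j0); rewrite ?mul1r ?mul0r ?subrr ?mulr0n ?subr0.
Qed.

(** * The state-space formula for the composition *)

Section StateSpace.
Variable C : fieldType.
Variables (n p m : nat).
Variables (A_L : 'M[C]_n) (B_L : 'M[C]_(n, p)) (C_L : 'M[C]_(p, n)).
Variables (D_L : 'M[C]_p).
Variables (A_R : 'M[C]_m) (b_R : 'cV[C]_m) (c_R : 'rV[C]_m) (d_R : C).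
Variable f_R : ratfun C.

(** By the mixed-product rule the left side is the identity tensored with a 1 x 1 matrix. *)
Lemma tens_feedback :
  let Y := (Defs.ratz C)%:M - cstmx A_R in
  cstmx (I_tens_c n c_R) *m ((1%:M : 'M_n) *t invmx Y) *m cstmx (I_tens_b n b_R) =
  ((cstmx c_R *m invmx Y *m cstmx b_R) 0 0)%:M.
Proof.
move=> Y; rewrite /cstmx /I_tens_b /I_tens_c !map_castmx !map_mxT !map_mx1.
have -> T : castmx (muln1 n, erefl) (1%:M *t (c_R ^ ratC C)%sesqui) *m T =
    castmx (muln1 n, erefl) (1%:M *t map_mx (ratC C) c_R *m T).
  by rewrite castmx_mul castmx_id.
rewrite -castmx_mul !tensmx_mul !mul1mx.
rewrite [in LHS](mx11_scalar (_ *m _ *m _)) tens_mx_scalar castmx_comp.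
by rewrite castmx_id scalemx1.
Qed.

Lemma tf_at_comp :
  (f_R%:M : 'M_1) = tf A_R b_R c_R d_R%:M ->
  d_R%:M - A_L \in unitmx -> f_R%:M - cstmx A_L \in unitmx ->
  tf_at f_R A_L B_L C_L D_L =
    tf (A_comp A_L A_R b_R c_R d_R) (B_comp A_L B_L b_R d_R)
       (C_comp A_L C_L c_R d_R) (D_comp A_L B_L C_L D_L d_R).
Proof.
move=> fE uL uM.
have cL : (ratC C d_R)%:M - cstmx A_L = cstmx (d_R%:M - A_L).
  by rewrite /cstmx map_mxB map_scalar_mx.
have cinvL : invmx ((ratC C d_R)%:M - cstmx A_L) = cstmx (invmx (d_R%:M - A_L)).
  by rewrite cL /cstmx map_invmx.
pose Y := (Defs.ratz C)%:M - cstmx A_R; pose X := (1%:M : 'M_n) *t Y.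
have XV : X *m (1%:M *t invmx Y) = 1%:M.
  rewrite tensmx_mul mul1mx mulmxV ?z_sub_cstmx_unit //.
  (* [tens_scalar_sub] at z = 1, N = 0: a Kronecker product of identities is the identity. *)
  by rewrite -[X in _ *t X]subr0 tens_scalar_sub tensmx0 subr0.
have [uX _] := mulmx1_unit XV.
have invX : invmx X = 1%:M *t invmx Y by rewrite -[LHS]mulmx1 -XV mulKmx.
set U := cstmx (I_tens_b n b_R); set V := cstmx (I_tens_c n c_R).
have zA : (Defs.ratz C)%:M - cstmx (A_comp A_L A_R b_R c_R d_R) =
    X + U *m invmx ((ratC C d_R)%:M - cstmx A_L) *m V.
  rewrite cinvL -!cstmxM /X tens_scalar_sub /A_comp /cstmx map_mxB map_mxT map_mx1.
  by rewrite opprB addrA addrAC.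
have cst_d : cstmx (d_R%:M : 'M_1) 0 0 = ratC C d_R by rewrite !mxE mulr1n.
have VXU : V *m invmx X *m U = (f_R - ratC C d_R)%:M.
  rewrite invX tens_feedback; congr _%:M.
  have := congr1 (fun M : 'M_1 => M 0 0) fE.
  rewrite mxE mulr1n => ->; rewrite [tf _ _ _ _ _ _]mxE cst_d.
  by rewrite [X in _ = X - _]addrC addrK.
have uL' : (ratC C d_R)%:M - cstmx A_L \in unitmx by rewrite cL /cstmx map_unitmx.
have uY := z_sub_cstmx_unit (A_comp A_L A_R b_R c_R d_R).
rewrite zA in uY.
(* The term L^-1 of the Woodbury formula yields [D_comp]; the minus sign of the other term is the
   one in [B_comp]. *)
rewrite /tf /tf_at zA (woodbury_feedback uX uL' uM uY VXU) cinvL.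
rewrite /B_comp /C_comp /D_comp /cstmx map_mxN map_mxD -!/(cstmx _) !cstmxM.
by rewrite -/U -/V mulmxN mulmxBr mulmxBl !mulmxA addrA.
Qed.

End StateSpace.

Theorem proposition3p1 (R : realType) (n p m : nat)
    (A_L : 'M[R[i]]_n) (B_L : 'M[R[i]]_(n, p)) (C_L : 'M[R[i]]_(p, n))
    (D_L : 'M[R[i]]_p)
    (A_R : 'M[R[i]]_m) (b_R : 'cV[R[i]]_m) (c_R : 'rV[R[i]]_m) (d_R : R[i])
    (F_L : 'M[ratfun R[i]]_p) (f_R : ratfun R[i]) :
  mcmillan_degree F_L n ->
  minimal_realization F_L A_L B_L C_L D_L ->
  mcmillan_degree (f_R%:M : 'M_1) m ->
  minimal_realization (f_R%:M : 'M_1) A_R b_R c_R d_R%:M ->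
  composition_well_defined F_L f_R ->
  [/\ d_R%:M - A_L \in unitmx,
      f_R%:M - cstmx A_L \in unitmx,
      is_composition F_L f_R (tf_at f_R A_L B_L C_L D_L)
    & tf_at f_R A_L B_L C_L D_L =
        tf (A_comp A_L A_R b_R c_R d_R) (B_comp A_L B_L b_R d_R)
           (C_comp A_L C_L c_R d_R) (D_comp A_L B_L C_L D_L d_R)].
Proof.
move=> _ minF _ [fE _] wdF.
have [uL uM] := regular_of_composition_well_defined minF fE wdF.
have [-> _] := minF.
by split; [| |exact: tf_is_composition |exact: tf_at_comp].
Qed.
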